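(* The stochastic TR-BDF2 scheme is $A$-stable. That is, applied to the test equation ${\rm d}X_t=\lambda X_t\,{\rm d}t+\sigma\,{\rm d}W_t$, where $\lambda$ and $\sigma$ are complex numbers, it can be written in the recursive form $Y_{n+1}=G(z)Y_n+V_n$, where any $V_n$ does not depend on any $Y_n$, $n=0,1,\dots,N-1$, and $G$ is a mapping of the complex plane into itself; and its region of absolute stability $\{z\in\mathbb C:|G(z)|<1\}$ is the left half of the complex plane.
   Context: $W$ is a scalar Wiener process, $T>0$, $N\in\mathbb N$, $h=T/N$ is the step size, $z=\lambda h$, $t_n=nh$ and $t_{n+\gamma}=t_n+\gamma h$. The parameters are $\gamma=2-\sqrt2$, $\gamma_2=\frac{1-\gamma}{2-\gamma}$, $\gamma_3=\frac{1}{\gamma(2-\gamma)}$. Write $\Delta W_{s,t}=W_t-W_s$ and $I_{(1,0),s,t}=\int_s^t(W_r-W_s)\,{\rm d}r$. The stochastic TR-BDF2 scheme applied to the test equation ${\rm d}X_t=\lambda X_t\,{\rm d}t+\sigma\,{\rm d}W_t$ (drift $a(t,x)=\lambda x$, constant diffusion $\sigma$) reads: given $Y_0$, for $n=0,\dots,N-1$, $$Y_{n+\gamma}=Y_n+\tfrac12(Y_n+Y_{n+\gamma})z\gamma+\Delta W_{t_n,t_{n+\gamma}}\sigma\left(1-\tfrac12z\gamma\right)+I_{(1,0),t_n,t_{n+\gamma}}\sigma\lambda,$$ $$Y_{n+1}=\gamma_3Y_{n+\gamma}+(1-\gamma_3)Y_n+Y_{n+1}z\gamma_2+\Delta W_{t_n,t_{n+\gamma}}\sigma(1-z\gamma)(1-\gamma_3)+I_{(1,0),t_n,t_{n+\gamma}}\sigma\lambda(1-\gamma_3)+\Delta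 W_{t_{n+\gamma},t_{n+1}}\sigma(1-z\gamma_2)+I_{(1,0),t_{n+\gamma},t_{n+1}}\sigma\lambda.$$ $G(z)$ is the coefficient of $Y_n$ obtained by combining these equations and solving for $Y_{n+1}$, and $V_n$ collects the remaining (noise) terms of the step.
   Formalization: The region {|G(z)|<1} is shown to contain the left half-plane, not to equal it: equality is false, as G(z) tends to 0 at infinity, so |G(z)|<1 also for large z with Re z>0. The recursion is stated for z where the implicit equations are solvable, i.e. away from the pole of G. *)

(* Defs.v *)
From HB Require Import structures.
From mathcomp Require Import all_boot all_order all_algebra.
From mathcomp Require Import all_classical all_reals all_analysis.
From mathcomp Require Export complex.

Set Implicit Arguments.
Unset Strict Implicit.
Unset Printing Implicit Defensive.

Import Order.TTheory GRing.Theory Num.Theory.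
Import numFieldNormedType.Exports.

Local Open Scope classical_set_scope.
Local Open Scope ring_scope.
Local Open Scope complex_scope.

Section Increments.
Context (R : realType) (d : measure_display) (Omega : measurableType d).
Context (P : probability Omega R) (W : R -> {RV P >-> R}).

Definition DeltaW (s t : R) (w : Omega) : R := W t w - W s w.

Definition I10 (s t : R) (w : Omega) : R :=
  Rintegral lebesgue_measure `[s, t] (fun r => W r w - W s w).

End Increments.

(* The index set of W is R; only the times t >= 0 are constrained.
   The second parameter of normal_prob is the standard deviation. *)
Record wiener_process (R : realType) (d : measure_display)
    (Omega : measurableType d) (P : probability Omega R)
    (W : R -> {RV P >-> R}) : Prop := WienerProcess {
  wiener_start : {ae P, forall w, W 0 w = 0} ;
  wiener_indep_increments :
    forall (k : nat) (t : nat -> R),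
      0 <= t 0%N -> (forall i, (i < k)%N -> t i < t i.+1) ->
      forall B : nat -> set R, (forall i, measurable (B i)) ->
      P (\bigcap_(i in [set i | (i < k)%N])
           DeltaW W (t i) (t i.+1) @^-1` B i)
      = (\prod_(i < k) P (DeltaW W (t i) (t i.+1) @^-1` B i))%E ;
  wiener_gaussian_increments :
    forall s t : R, 0 <= s -> s < t ->
      forall B : set R, measurable B ->
      P (DeltaW W s t @^-1` B) = normal_prob 0 (Num.sqrt (t - s)) B ;
  wiener_continuous_paths :
    {ae P, forall w, {within [set t : R | 0 <= t], continuous (fun t => W t w)}}
}.

Section Scheme.
Context (R : realType).

Definition gamma : R := 2 - Num.sqrt 2.
Definition gamma2 : R := (1 - gamma) / (2 - gamma).
Definition gamma3 : R := (gamma * (2 - gamma))^-1.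

(* One step y |-> y' with intermediate value yg; dW1, i1 and dW2, i2 are the
   values of DeltaW and I10 on [t_n, t_(n+gamma)] and [t_(n+gamma), t_(n+1)]. *)
Definition trbdf2_step (h : R) (lambda sigma : R[i]) (dW1 i1 dW2 i2 : R)
    (y yg y' : R[i]) : Prop :=
  let z := lambda * h%:C in
  let g := gamma%:C in let g2 := gamma2%:C in let g3 := gamma3%:C in
  yg = y + 2^-1 * (y + yg) * z * g
       + dW1%:C * sigma * (1 - 2^-1 * z * g) + i1%:C * sigma * lambda
  /\
  y' = g3 * yg + (1 - g3) * y + y' * z * g2
       + dW1%:C * sigma * (1 - z * g) * (1 - g3)
       + i1%:C * sigma * lambda * (1 - g3)
       + dW2%:C * sigma * (1 - z * g2) + i2%:C * sigma * lambda.

Definition trbdf2_time (h : R) (n : nat) : R := n%:R * h.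

Definition trbdf2_gtime (h : R) (n : nat) : R := trbdf2_time h n + gamma * h.

(* Evaluates f at the four noise terms of step n. *)
Definition step_noise (d : measure_display) (Omega : measurableType d)
    (P : probability Omega R) (W : R -> {RV P >-> R}) (h : R) (n : nat)
    (w : Omega) (S : Type) (f : R -> R -> R -> R -> S) : S :=
  let t := trbdf2_time h n in
  let tg := trbdf2_gtime h n in
  let t' := trbdf2_time h n.+1 in
  f (DeltaW W t tg w) (I10 W t tg w) (DeltaW W tg t' w) (I10 W tg t' w).

Definition trbdf2 (d : measure_display) (Omega : measurableType d)
    (P : probability Omega R) (W : R -> {RV P >-> R}) (h : R) (N : nat)
    (lambda sigma : R[i]) (Y : nat -> Omega -> R[i]) : Prop :=
  exists Yg : nat -> Omega -> R[i],
    forall n, (n < N)%N -> forall w,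
      step_noise W h n w (fun dW1 i1 dW2 i2 =>
        trbdf2_step h lambda sigma dW1 i1 dW2 i2 (Y n w) (Yg n w) (Y n.+1 w)).

(* The coefficients of the unknowns Y_(n+gamma) and Y_(n+1) in the two implicit
   equations are nonzero. Outside this set G has a pole; since x / 0 = 0 here,
   the pole has to be excluded explicitly from the region of stability. *)
Definition trbdf2_solvable : set R[i] :=
  [set z | 1 - 2^-1 * z * gamma%:C != 0 /\ 1 - z * gamma2%:C != 0].

Definition stability_region (D : set R[i]) (G : R[i] -> R[i]) : set R[i] :=
  [set z | D z /\ `|G z| < 1].

Definition left_half_plane : set R[i] := [set z | complex.Re z < 0].

(* Absolute stability is only asked about for Re z < 0, so the left half-plane
   has to be contained in the region. Equality with the full set
   {z | |G z| < 1} is not meant: for this scheme G z tends to 0 as |z| tends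
   to infinity, so that set also has points with Re z > 0. *)
Definition A_stable (D : set R[i]) (G : R[i] -> R[i]) : Prop :=
  left_half_plane `<=` stability_region D G.

End Scheme.

(* Main.v *)
Require Import Defs.
From HB Require Import structures.
From mathcomp Require Import all_boot all_order all_algebra.
From mathcomp Require Import all_classical all_reals all_analysis.
From mathcomp Require Import complex.
From mathcomp Require Import ring lra.
Import Order.TTheory GRing.Theory Num.Theory.
Import numFieldNormedType.Exports.
Local Open Scope classical_set_scope.
Local Open Scope ring_scope.
Local Open Scope complex_scope.

(** A step of the scheme is a pair of linear implicit equations, in which the
    two unknowns have the coefficients [1 - z gamma / 2] and [1 - z gamma2].
    When both are nonzero, each equation can be solved: the intermediate value
    is an affine function of [y], and its substitution in the second equation
    gives [y' = G(z) y + V], where [V] depends on the noise only.  This is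
    [trbdf2_stepP].  It is an equivalence, because an intermediate value can
    be recovered from [y].

    For the special value [gamma = 2 - sqrt 2] the two coefficients coincide,
    since [gamma2 = gamma / 2], and with [u = gamma2 z] the amplification
    factor is [G(z) = (1 + sqrt 2 u) / (1 - u)^2] ([amplificationE]).  If
    [u = x + i y] and [q = |u|^2], then
      [|1 - u|^4 - |1 + sqrt 2 u|^2 = 4 x^2 + q^2 - (4 + 2 sqrt 2) x - 4 x q],
    because the terms [2 q] cancel.  For [x < 0] no summand is negative and
    the third one is positive, so [|G(z)| < 1] ([norm_amplification_lt1]).  The
    coefficient [1 - u] does not vanish there, as its real part is above 1. *)

Definition amplification {R : realType} (z : R[i]) : R[i] :=
  ((gamma3 R)%:C
     * ((1 + 2^-1 * z * (gamma R)%:C) / (1 - 2^-1 * z * (gamma R)%:C))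
   + (1 - (gamma3 R)%:C)) / (1 - z * (gamma2 R)%:C).

Definition stage_noise {R : realType} (z lambda sigma : R[i]) (dW1 i1 : R) :
    R[i] :=
  dW1%:C * sigma * (1 - 2^-1 * z * (gamma R)%:C) + i1%:C * sigma * lambda.

Definition stage_value {R : realType} (z lambda sigma : R[i]) (dW1 i1 : R)
    (y : R[i]) : R[i] :=
  ((1 + 2^-1 * z * (gamma R)%:C) * y + stage_noise z lambda sigma dW1 i1)
  / (1 - 2^-1 * z * (gamma R)%:C).

(** The first stage contributes twice: through the intermediate value, which
    gives the first summand, and through the correction terms in [1 - gamma3]
    of the second equation. *)
Definition noise_term {R : realType} (z lambda sigma : R[i])
    (dW1 i1 dW2 i2 : R) : R[i] :=
  ((gamma3 R)%:C * stage_value z lambda sigma dW1 i1 0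
   + dW1%:C * sigma * (1 - z * (gamma R)%:C) * (1 - (gamma3 R)%:C)
   + i1%:C * sigma * lambda * (1 - (gamma3 R)%:C)
   + dW2%:C * sigma * (1 - z * (gamma2 R)%:C) + i2%:C * sigma * lambda)
  / (1 - z * (gamma2 R)%:C).

Lemma linear_implicitP (F : fieldType) (b c x : F) :
  1 - c != 0 -> x = b + x * c <-> x = b / (1 - c).
Proof.
move=> c1; split=> [xE|->]; last by field.
by apply: (canRL (mulfK c1)); rewrite mulrBr mulr1 {1}xE addrK.
Qed.

Lemma trbdf2_stepP (R : realType) (h : R) (lambda sigma : R[i])
    (dW1 i1 dW2 i2 : R) (y yg y' : R[i]) :
  let z := lambda * h%:C in
  trbdf2_solvable z ->
  trbdf2_step h lambda sigma dW1 i1 dW2 i2 y yg y' <->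
  yg = stage_value z lambda sigma dW1 i1 y /\
  y' = amplification z * y + noise_term z lambda sigma dW1 i1 dW2 i2.
Proof.
move=> z [cg c2]; rewrite /trbdf2_step -/z.
set eq1 := (X in X /\ _); set eq2 := (X in _ /\ X).
(* The fixed-point form [x = b + x c] of an implicit equation differs from the
   scheme only by regrouping terms. *)
have stageP : eq1 <-> yg = stage_value z lambda sigma dW1 i1 y.
  rewrite /stage_value -(linear_implicitP _ _ _ _ cg) /eq1 /stage_noise.
  set r := (X in yg = X <-> _); set r' := (X in _ <-> yg = X).
  by have -> : r = r' by rewrite /r /r'; ring.
(* The second equation becomes linear in [y'] alone only once [yg] has been
   replaced by its value. *)
have outputP : yg = stage_value z lambda sigma dW1 i1 y ->
    eq2 <-> y' = amplification z * y
                 + noise_term z lambda sigma dW1 i1 dW2 i2.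
  rewrite /eq2 => ->.
  set r := (X in _ <-> y' = X).
  have -> : r = ((gamma3 R)%:C * stage_value z lambda sigma dW1 i1 y
      + (1 - (gamma3 R)%:C) * y
      + dW1%:C * sigma * (1 - z * (gamma R)%:C) * (1 - (gamma3 R)%:C)
      + i1%:C * sigma * lambda * (1 - (gamma3 R)%:C)
      + dW2%:C * sigma * (1 - z * (gamma2 R)%:C) + i2%:C * sigma * lambda)
      / (1 - z * (gamma2 R)%:C).
    by rewrite /r /noise_term /stage_value /amplification; ring.
  rewrite -(linear_implicitP _ _ _ _ c2).
  set s := (X in y' = X <-> _); set s' := (X in _ <-> y' = X).
  by have -> : s = s' by rewrite /s /s'; ring.
split=> -[].
  by move=> /stageP ygE /(outputP ygE) y'E.
by move=> ygE y'E; split; [apply/stageP | apply/(outputP ygE)].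
Qed.

Lemma sqrt2_gt0 (R : realType) : 0 < Num.sqrt 2 :> R.
Proof. by rewrite sqrtr_gt0 ltr0n. Qed.

Lemma sqr_sqrt2 (R : realType) : Num.sqrt 2 ^+ 2 = 2 :> R.
Proof. by rewrite sqr_sqrtr ?ler0n. Qed.

Lemma gamma2E (R : realType) : gamma2 R = 1 - Num.sqrt 2 / 2.
Proof.
have s0 := sqrt2_gt0 R; have s2 := sqr_sqrt2 R.
rewrite /gamma2 /gamma.
have -> : 2 - (2 - Num.sqrt 2) = Num.sqrt 2 :> R by ring.
by apply: (canLR (mulfK _)); [rewrite gt_eqF | lra].
Qed.

Lemma gammaE (R : realType) : gamma R = 2 * gamma2 R.
Proof. by rewrite gamma2E /gamma; field. Qed.

Lemma gamma2_gt0 (R : realType) : 0 < gamma2 R.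
Proof. by have := sqrt2_gt0 R; have := sqr_sqrt2 R; rewrite gamma2E; nra. Qed.

Lemma gamma3E (R : realType) : 2 * gamma3 R - 1 = Num.sqrt 2.
Proof.
have s0 := sqrt2_gt0 R; have s2 := sqr_sqrt2 R.
rewrite /gamma3.
have -> : gamma R * (2 - gamma R) = 2 * (Num.sqrt 2 - 1).
  by rewrite /gamma; lra.
have d0 : 2 * (Num.sqrt 2 - 1) != 0 :> R by rewrite gt_eqF //; nra.
by apply: (canLR (addrK _)); apply: (canLR (mulfK d0)); lra.
Qed.

(** This is where the choice of [gamma] enters: it makes the two implicit
    equations share one coefficient, so that [G] has a single double pole. *)
Lemma stage_coefE (R : realType) (z : R[i]) :
  2^-1 * z * (gamma R)%:C = z * (gamma2 R)%:C.
Proof. by rewrite gammaE rmorphM rmorph_nat; field. Qed.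

(** With [u = z gamma / 2 = z gamma2], the numerator over the common
    denominator is [gamma3 (1 + u) + (1 - gamma3) (1 - u)
    = 1 + (2 gamma3 - 1) u], and [2 gamma3 - 1 = sqrt 2]. *)
Lemma amplificationE (R : realType) (z : R[i]) :
  let u := z * (gamma2 R)%:C in
  1 - u != 0 ->
  amplification z = (1 + (Num.sqrt 2)%:C * u) / (1 - u) ^+ 2.
Proof.
move=> u u1; rewrite /amplification stage_coefE -/u -gamma3E.
rewrite rmorphB rmorphM rmorph_nat rmorph1.
by field.
Qed.

Lemma Re_lt0_neq (R : realType) (u : R[i]) : complex.Re u < 0 -> 1 - u != 0.
Proof.
case: u => x y /= x0; apply/eqP => /(congr1 (@complex.Re R)) /=.
by move=> e; lra.
Qed.

(** The squared moduli are compared as polynomials in [x = Re u] and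
    [y = Im u].  With the factor [sqrt 2] both expansions contain the same term
    [2 |u|^2]; a larger factor would break the bound near the imaginary
    axis. *)
Lemma norm_amplification_lt1 (R : realType) (u : R[i]) :
  complex.Re u < 0 ->
  `|(1 + (Num.sqrt 2)%:C * u) / (1 - u) ^+ 2| < 1.
Proof.
move=> u0; have u1 := Re_lt0_neq R u u0.
rewrite normrM normfV normrX.
rewrite ltr_pdivrMr ?exprn_gt0 ?normr_gt0 // mul1r.
rewrite -(@ltr_pXn2r _ 2) ?nnegrE ?exprn_ge0 ?normr_ge0 //.
rewrite -!add_Re2_Im2 -rmorphXn ltcR.
case: u u0 {u1} => x y /= x0.
have s0 := sqrt2_gt0 R; have s2 := sqr_sqrt2 R.
set s := Num.sqrt 2 in s0 s2 *; pose q := x ^+ 2 + y ^+ 2.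
have q0 : 0 <= q by rewrite addr_ge0 ?sqr_ge0.
(* The last summand vanishes because [s ^+ 2 = 2]; it is split off so that the
   expansion is an identity in [s]. *)
rewrite -subr_gt0; set diff := (X in 0 < X).
have -> : diff = 4 * x ^+ 2 + q ^+ 2 + (4 + 2 * s) * - x + 4 * (- x) * q
                 + (2 - s ^+ 2) * q.
  by rewrite /diff /q; ring.
rewrite s2 subrr mul0r addr0 ltr_wpDr ?ltr_wpDl //.
- by rewrite mulr_ge0 // mulr_ge0 ?ler0n // oppr_ge0 ltW.
- by rewrite addr_ge0 ?sqr_ge0 // mulr_ge0 ?ler0n ?sqr_ge0.
- by rewrite mulr_gt0 ?oppr_gt0 // addr_gt0 ?mulr_gt0 ?ltr0n.
Qed.

Theorem proposition4p3 (R : realType) :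
  exists G : R[i] -> R[i],
    (forall (T : R) (N : nat) (lambda sigma : R[i]),
       0 < T -> (0 < N)%N ->
       let h := T / N%:R in
       let z := lambda * h%:C in
       trbdf2_solvable z ->
       exists v : R -> R -> R -> R -> R[i],
       forall (d : measure_display) (Omega : measurableType d)
         (P : probability Omega R) (W : R -> {RV P >-> R}),
         wiener_process W ->
         let V := fun (n : nat) (w : Omega) => step_noise W h n w v in
         forall Y : nat -> Omega -> R[i],
           trbdf2 W h N lambda sigma Y <->
           (forall n, (n < N)%N -> forall w, Y n.+1 w = G z * Y n w + V n w))
    /\ A_stable (@trbdf2_solvable R) G.
Proof.
exists amplification; split=> [T N lambda sigma _ _ h z zP|z z0].
  exists (noise_term z lambda sigma) => d Omega P W _ V Y; split.
    move=> [Yg YgP] n nN w.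
    by case/(trbdf2_stepP _ _ _ _ _ _ _ _ _ _ _ zP): (YgP n nN w).
  move=> YP.
  (* Any solution of the recursion determines its intermediate values. *)
  exists (fun n w => step_noise W h n w (fun dW1 i1 _ _ =>
    stage_value z lambda sigma dW1 i1 (Y n w))) => n nN w.
  apply/(trbdf2_stepP _ _ _ _ _ _ _ _ _ _ _ zP); split=> //.
  exact: YP.
have u0 : complex.Re (z * (gamma2 R)%:C) < 0.
  have := gamma2_gt0 R; move: z0; rewrite /left_half_plane /=.
  by case: z => x y /= x0 g0; rewrite mulr0 subr0 nmulr_rlt0.
have u1 := Re_lt0_neq R _ u0.
split; first by split; rewrite ?stage_coefE.
by rewrite amplificationE //; apply: norm_amplification_lt1.
Qed.
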